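(* Let $(W,S)$ be a Coxeter system, let $G$ be a group of automorphisms of $(W,S)$, and let $W':=W^G=\{w\in W\mid \sigma(w)=w\text{ for all }\sigma\in G\}$. Let $S'$ be the set of longest elements $w_J$ of finite standard parabolic subgroups $W_J$ of $W$ such that $J\subseteq S$ is a single $G$-orbit on $S$. Let $\mathcal R:=\mathcal C_{(W,S)}$ denote the standard rootoid attached to $(W,S)$, let $i\colon W'\to W$ be the inclusion homomorphism, and let $\mathcal T:=\mathcal R_{W'}=i^{\natural}\mathcal R$ be the restriction of $\mathcal R$ to $W'$. Then $\mathcal T$ is a preprincipal rootoid with set of atomic generators $S'$, and the natural morphism $i^{\flat}\colon\mathcal T\to\mathcal R$ is a morphism in the category $\mathbf{RdE}$ of rootoid local embeddings.
   Context: An automorphism of $(W,S)$ is a group automorphism of $W$ preserving $S$. Groups are regarded as one-object groupoids. Boolean rings are possibly non-unital rings in which $x^2=x$, ordered by $x\subseteq y$ iff $xy=x$, with $x\cap y:=xy$. For a groupoid $G$ and objects $a,b$, ${}_aG_b:=\mathrm{Hom}_G(b,a)$ and ${}_aG:=\bigcup_b{}_aG_b$. A protorootoid is a triple $(G,\Lambda,N)$ with $G$ a groupoid, $\Lambda$ a functor from $G$ to Boolean rings, and $N$ a $1$-cocycle: $N(g)\in\Lambda(a)$ for $g\in{}_aG$ and $N(gh)=N(g)+\Lambda(g)(N(h))$ whenever $gh$ is defined. It is faithful if $N(g)=0$ implies $g$ is an identity morphism. Its weak right preorder at $a$ is the preorder on ${}_aG$ with $x\le y$ iff $N(x)\subseteq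 N(y)$ (a partial order, isomorphic via $N$ to ${}_a\mathcal L:=\{N(g)\mid g\in{}_aG\}$, in the faithful case). A morphism $(G,\Lambda,N)\to(H,\Gamma,M)$ is a pair $(\alpha,\nu)$ of a groupoid homomorphism $\alpha\colon G\to H$ and a natural transformation $\nu\colon\Lambda\to\Gamma\alpha$ with $\nu_a(N(g))=M(\alpha(g))$. A rootoid is a faithful protorootoid such that for each object $a$: (1) ${}_aG$ in its weak right order is a complete meet semilattice (every non-empty subset has a meet), and (2) (JOP) if a non-empty family $(x_i)$ in ${}_aG$ has a join $x$ in ${}_aG$ and $y\in{}_aG$ satisfies $N(x_i)\cap N(y)=0$ for all $i$, then $N(x)\cap N(y)=0$. A rootoid is preprincipal if all its weak right orders are interval finite (all closed intervals are finite) and for each object $a$, each atom $r$ of ${}_aG$ (i.e. minimal element of ${}_aG\setminus\{1_a\}$) and each $g\in{}_aG$, either $N(r)\subseteq N(g)$ or $N(r)\cap N(g)=0$. The atomic generators are the atoms of the weak right orders ${}_aG$ for all objects $a$. Standard rootoid of $(W,S)$: $\mathcal C_{(W,S)}=(W,\Lambda,N)$, where $T=\{wsw^{-1}\mid w\in W,s\in S\}$, $\Lambda$ is the Boolean ring $\wp(T)$ of subsets of $T$ (addition is symmetric difference, multiplication is intersection) with $W$-action induced by conjugation on $T$, and $N(w)=\{t\in T\mid l(tw)<l(w)\}$, $l$ being the length function of $(W,S)$; its weak right order is the usual one. For a subgroup $W'\subseteq W$ with inclusion $i$, $i^\natural\mathcal R$ is $(W',\Lambda|_{W'},N|_{W'})$,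 and $i^\flat=(i,\mathrm{Id})\colon i^\natural\mathcal R\to\mathcal R$. A morphism $f=(\alpha,\nu)$ of protorootoids between rootoids with underlying groupoids $H'$ and $H$ is a morphism in $\mathbf{RdE}$ (a rootoid local embedding) if for each object $a$ of $H'$ the induced map $\theta\colon{}_aH'\to{}_{\alpha(a)}H$ of weak right orders is an order isomorphism onto its image, this image is a join-closed meet subsemilattice of ${}_{\alpha(a)}H$ (closed under meets of its non-empty subsets and under those joins of its non-empty subsets which exist in ${}_{\alpha(a)}H$), and the AOP (adjunction orthogonality property) holds: for every $u\in{}_aH'$ and every $w\in{}_{\alpha(a)}H$ lying in the order ideal generated by the image of $\theta$, if $N(\theta(u))\cap N(w)=0$ then $N(u)\cap N(\theta^\perp(w))=0$, where $\theta^\perp(w)$ denotes the minimum element of $\{v\in{}_aH'\mid w\leq\theta(v)\}$ (here $N$ denotes the cocycle of the respective rootoid). *)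

(* Defs.v *)
From HB Require Import structures.
From mathcomp Require Import all_boot ssralg all_classical.

Set Implicit Arguments.
Unset Strict Implicit.
Unset Printing Implicit Defensive.

Local Open Scope classical_set_scope.
Local Open Scope group_scope.

(* Commutativity and characteristic 2 follow from idempotence. *)
HB.mixin Record Zmodule_isBooleanRing R of GRing.Zmodule R := {
  cap : R -> R -> R;
  capA : associative cap;
  capDl : left_distributive cap +%R;
  capDr : right_distributive cap +%R;
  capxx : idempotent_op cap
}.

#[short(type="booleanRingType")]
HB.structure Definition BooleanRing :=
  {R of GRing.Zmodule R & Zmodule_isBooleanRing R}.

Definition subb (R : booleanRingType) (x y : R) : Prop := cap x y = x.

Definition boolean_ring_morphism (R R' : booleanRingType) (f : R -> R') : Prop :=
  {morph f : x y / (x + y)%R} /\ {morph f : x y / cap x y}.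

Section PowerSet.
Variable X : Type.

Fact setY_left_inverse : left_inverse (@set0 X) id setY.
Proof. by move=> A; exact: setYK. Qed.

HB.instance Definition _ := Algebra.isZmodule.Build (set X)
  (@setYA X) (@setYC X) (@set0Y X) setY_left_inverse.

HB.instance Definition _ := Zmodule_isBooleanRing.Build (set X)
  (@setIA X) (@setIYl X) (@setIYr X) (@setIid X).

End PowerSet.

(* [hom a b] is Hom(b, a), so that [comp g h] is the composite gh. *)
Record groupoid := Groupoid {
  ob :> Type;
  hom : ob -> ob -> Type;
  comp : forall a b c, hom a b -> hom b c -> hom a c;
  idm : forall a, hom a a;
  invm : forall a b, hom a b -> hom b a;
  compA : forall a b c d (f : hom a b) (g : hom b c) (h : hom c d),
    comp f (comp g h) = comp (comp f g) h;
  comp1m : forall a b (g : hom a b), comp (idm a) g = g;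
  compm1 : forall a b (g : hom a b), comp g (idm b) = g;
  compVm : forall a b (g : hom a b), comp (invm g) g = idm b;
  compmV : forall a b (g : hom a b), comp g (invm g) = idm a
}.

Record groupoid_hom (H G : groupoid) := GroupoidHom {
  hom_ob :> H -> G;
  hom_map : forall a b, hom a b -> hom (hom_ob a) (hom_ob b);
  hom_map1 : forall a, hom_map (idm a) = idm (hom_ob a);
  hom_mapM : forall a b c (g : hom a b) (h : hom b c),
    hom_map (comp g h) = comp (hom_map g) (hom_map h)
}.

Arguments hom_map {H G} _ {a b} g.

(* The set [_aG] of the morphisms of codomain [a]. *)
Definition star (G : groupoid) (a : G) : Type := {b : G & hom a b}.

Definition in_star (G : groupoid) (a b : G) (g : hom a b) : star a :=
  existT (fun b => hom a b) b g.

Definition star1 (G : groupoid) (a : G) : star a := in_star (idm a).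

Definition star_map (H G : groupoid) (alpha : groupoid_hom H G) (a : H)
    (x : star a) : star (alpha a) :=
  in_star (hom_map alpha (projT2 x)).

Record boolean_functor (G : groupoid) := BooleanFunctor {
  fun_ob :> G -> booleanRingType;
  fun_map : forall a b, hom a b -> fun_ob b -> fun_ob a;
  fun_map_morph : forall a b (g : hom a b), boolean_ring_morphism (fun_map g);
  fun_map1 : forall a x, fun_map (idm a) x = x;
  fun_mapM : forall a b c (g : hom a b) (h : hom b c) x,
    fun_map (comp g h) x = fun_map g (fun_map h x)
}.

Arguments fun_map {G} _ {a b} g x.

Section PullbackFunctor.
Variables (H G : groupoid) (alpha : groupoid_hom H G) (L : boolean_functor G).

Let pmap (a b : H) (g : hom a b) : L (alpha b) -> L (alpha a) :=
  fun_map L (hom_map alpha g).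

Fact pullback_map1 a x : pmap (idm a) x = x.
Proof. by rewrite /pmap hom_map1 fun_map1. Qed.

Fact pullback_mapM a b c (g : hom a b) (h : hom b c) x :
  pmap (comp g h) x = pmap g (pmap h x).
Proof. by rewrite /pmap hom_mapM fun_mapM. Qed.

Definition pullback_functor : boolean_functor H := BooleanFunctor
  (fun a b g => fun_map_morph L (hom_map alpha g)) pullback_map1 pullback_mapM.

End PullbackFunctor.

(* A triple (G, Lambda, N). The cocycle identity is kept apart, in
   [is_protorootoid]: for the triple attached to a Coxeter system it is a
   theorem, and it is part of [is_rootoid]. *)
Record triple := Triple {
  gpd : groupoid;
  lam : boolean_functor gpd;
  coc : forall a b : gpd, hom a b -> lam a
}.

Definition is_protorootoid (R : triple) : Prop :=
  forall (a b c : gpd R) (g : hom a b) (h : hom b c),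
    coc (comp g h) = (coc g + fun_map (lam R) g (coc h))%R.

Definition is_faithful (R : triple) : Prop :=
  forall (a b : gpd R) (g : hom a b), coc g = 0%R -> in_star g = star1 a.

Section WeakOrder.
Variables (R : triple) (a : gpd R).
Implicit Types (x y z : star a) (X : set (star a)).

Definition scoc x : lam R a := coc (projT2 x).

Definition wle x y : Prop := subb (scoc x) (scoc y).

Definition orth x y : Prop := cap (scoc x) (scoc y) = 0%R.

Definition is_meet X x : Prop :=
  (forall y, X y -> wle x y) /\ (forall z, (forall y, X y -> wle z y) -> wle z x).

Definition is_join X x : Prop :=
  (forall y, X y -> wle y x) /\ (forall z, (forall y, X y -> wle y z) -> wle x z).

Definition is_minimum X x : Prop := X x /\ (forall y, X y -> wle x y).

Definition complete_meet_semilattice : Prop :=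
  forall X, X !=set0 -> exists x, is_meet X x.

Definition JOP : Prop :=
  forall X x y, X !=set0 -> is_join X x ->
    (forall z, X z -> orth z y) -> orth x y.

Definition interval_finite : Prop :=
  forall x y, finite_set [set z | wle x z /\ wle z y].

Definition is_atom x : Prop :=
  x <> star1 a /\ (forall z, z <> star1 a -> wle z x -> z = x).

End WeakOrder.

Definition is_rootoid (R : triple) : Prop :=
  [/\ is_protorootoid R, is_faithful R,
      forall a : gpd R, complete_meet_semilattice a &
      forall a : gpd R, JOP a].

Definition is_preprincipal (R : triple) : Prop :=
  [/\ is_rootoid R,
      forall a : gpd R, interval_finite a &
      forall (a : gpd R) (r g : star a), is_atom r -> wle r g \/ orth r g].

Definition atomic_generators (R : triple) : set {a : gpd R & star a} :=
  [set r | is_atom (projT2 r)].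

Record triple_morphism (R' R : triple) := TripleMorphism {
  mor_gpd : groupoid_hom (gpd R') (gpd R);
  mor_nat : forall a, lam R' a -> lam R (mor_gpd a);
  mor_nat_morph : forall a, boolean_ring_morphism (@mor_nat a);
  mor_natural : forall a b (g : hom a b) x,
    mor_nat (fun_map (lam R') g x) =
    fun_map (lam R) (hom_map mor_gpd g) (mor_nat x);
  mor_coc : forall a b (g : hom a b),
    mor_nat (coc g) = coc (hom_map mor_gpd g)
}.

Section LocalEmbedding.
Variables (R' R : triple) (f : triple_morphism R' R) (a : gpd R').

Let theta : star a -> star (mor_gpd f a) := star_map (mor_gpd f) (a := a).

Definition order_iso_onto_image : Prop :=
  injective theta /\ (forall x y, wle (theta x) (theta y) <-> wle x y).

Definition join_closed_meet_subsemilattice : Prop :=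
  forall X : set (star (mor_gpd f a)), X !=set0 -> X `<=` range theta ->
    (forall x, is_meet X x -> range theta x) /\
    (forall x, is_join X x -> range theta x).

(* [v] is theta^perp(w). *)
Definition is_theta_perp (w : star (mor_gpd f a)) (v : star a) : Prop :=
  is_minimum [set v | wle w (theta v)] v.

Definition AOP : Prop :=
  forall (u : star a) (w : star (mor_gpd f a)),
    (exists v, wle w (theta v)) -> orth (theta u) w ->
    exists2 v, is_theta_perp w v & orth u v.

End LocalEmbedding.

Definition is_RdE_morphism (R' R : triple) (f : triple_morphism R' R) : Prop :=
  [/\ is_rootoid R', is_rootoid R &
      forall a : gpd R', [/\ order_iso_onto_image f a,
                             join_closed_meet_subsemilattice f a & AOP f a]].

(* [pullback i] is i^natural R and [pullback_morphism i] is i^flat. *)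
Section Pullback.
Variables (R : triple) (H : groupoid) (i : groupoid_hom H (gpd R)).

Definition pullback : triple :=
  @Triple H (pullback_functor i (lam R)) (fun a b g => coc (hom_map i g)).

Definition pullback_morphism : triple_morphism pullback R :=
  @TripleMorphism pullback R i (fun _ x => x)
    (fun _ => conj (fun _ _ => erefl) (fun _ _ => erefl))
    (fun _ _ _ _ => erefl) (fun _ _ _ => erefl).

End Pullback.

Definition group_groupoid (W : groupType) : groupoid :=
  @Groupoid unit (fun _ _ => W) (fun _ _ _ x y => x * y) (fun _ => 1)
    (fun _ _ x => x^-1) (fun _ _ _ _ => @mulgA W)
    (fun _ _ => @mul1g W) (fun _ _ => @mulg1 W)
    (fun _ _ => @mulVg W) (fun _ _ => @mulgV W).

Fact multiplicative1 (H W : groupType) (f : {multiplicative H -> W}) : f 1 = 1.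
Proof. by apply: (mulgI (f 1)); rewrite -gmulfM !mulg1. Qed.

Definition group_groupoid_hom (H W : groupType) (f : {multiplicative H -> W}) :
    groupoid_hom (group_groupoid H) (group_groupoid W) :=
  @GroupoidHom (group_groupoid H) (group_groupoid W) (fun a => a)
    (fun _ _ x => f x) (fun _ => multiplicative1 f)
    (fun _ _ _ x y => gmulfM (s := f) x y).

Definition group_elt (W : groupType)
    (r : {a : group_groupoid W & star a}) : W := projT2 (projT2 r).

Section Coxeter.
Variable W : groupType.
Implicit Types (S J : set W) (w : W).

Definition is_subgroup (H : set W) : Prop :=
  [/\ H 1, forall x y, H x -> H y -> H (x * y) & forall x, H x -> H x^-1].

Definition subgroup_generated (A : set W) : set W := smallest is_subgroup A.

(* W has the presentation with generators S and relations (st)^m(s,t) = 1,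
   m(s,t) being the order of st in W when it is finite: the third clause is the
   universal property, (st)^n = 1 being equivalent to m(s,t) | n. *)
Definition coxeter_system S : Prop :=
  [/\ forall s, S s -> s <> 1 /\ s * s = 1,
      subgroup_generated S = setT &
      forall (H : groupType) (f : W -> H),
        (forall s t n, S s -> S t -> (s * t) ^+ n = 1 -> (f s * f t) ^+ n = 1) ->
        exists phi : {multiplicative W -> H}, forall s, S s -> phi s = f s].

Definition is_expression S w (ss : seq W) : Prop :=
  (forall s, s \in ss -> S s) /\ w = \prod_(s <- ss) s.

(* [xget] only provides a default value when w is not a product of elements of
   S, which does not occur in a Coxeter system. *)
Definition coxeter_length S w : nat :=
  xget 0%N [set n | (exists2 ss, is_expression S w ss & size ss = n) /\
                    (forall ss, is_expression S w ss -> (n <= size ss)%N)].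

Definition reflections S : set W :=
  [set t | exists w, exists2 s, S s & t = w * s * w^-1].

Definition is_longest_element S J w : Prop :=
  subgroup_generated J w /\
  (forall v, subgroup_generated J v ->
    (coxeter_length S v <= coxeter_length S w)%N).

Definition is_automorphism S (sigma : W -> W) : Prop :=
  [/\ bijective sigma, {morph sigma : x y / x * y} & sigma @` S = S].

Record automorphism_group S := AutomorphismGroup {
  auts : set (W -> W);
  auts_automorphism : forall sigma, auts sigma -> is_automorphism S sigma;
  auts_id : auts id;
  auts_comp : forall sigma tau, auts sigma -> auts tau -> auts (sigma \o tau);
  auts_inv : forall sigma, auts sigma ->
    exists tau, [/\ auts tau, cancel sigma tau & cancel tau sigma]
}.

Definition is_orbit S (G : automorphism_group S) J : Prop :=
  exists2 s, S s & J = [set sigma s | sigma in auts G].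

Definition longest_elements_of_orbits S (G : automorphism_group S) : set W :=
  [set w | exists J, [/\ is_orbit G J, finite_set (subgroup_generated J) &
                         is_longest_element S J w]].

End Coxeter.

Section FixedGroup.
Variables (W : groupType) (S : set W) (G : automorphism_group S).

Definition fixed_points : {pred W} :=
  fun w => `[< forall sigma, auts G sigma -> sigma w = w >].

Fact fixed_points_group_closed : group_closed fixed_points.
Proof.
have morph1 sigma : auts G sigma -> sigma 1 = 1.
  move=> /auts_automorphism[_ sM _]; apply: (mulgI (sigma 1)).
  by rewrite -sM !mulg1.
split=> [|x y /asboolP xG /asboolP yG].
  by apply/asboolP => sigma; exact: morph1.
apply/asboolP => sigma Gs; have [_ sM _] := auts_automorphism Gs.
rewrite sM xG//; congr (_ * _); apply: (mulIg y).
by rewrite mulVg -{2}(yG _ Gs) -sM mulVg morph1.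
Qed.

Definition fixed_group : Type := {w : W | fixed_points w}.

HB.instance Definition _ := SubChoice.on fixed_group.
HB.instance Definition _ := SubChoice_isSubGroup.Build W fixed_points fixed_group
  fixed_points_group_closed.

Definition fixed_inclusion : {multiplicative fixed_group -> W} :=
  (val : fixed_group -> W).

End FixedGroup.

Section StandardRootoid.
Variables (W : groupType) (S : set W).

Local Notation T := (reflections S).

Fact reflections_conj w (t : T) : w * val t * w^-1 \in T.
Proof.
case: t => _ /= /set_mem[v [s Ss ->]]; apply/mem_set.
by exists (w * v), s => //; rewrite invgM !mulgA.
Qed.

Definition conj_reflection w (t : T) : T :=
  Sub (w * val t * w^-1) (reflections_conj w t).

Definition conj_map w (A : set T) : set T := conj_reflection w @` A.

Fact conj_reflection1 t : conj_reflection 1 t = t.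
Proof. by apply: val_inj; rewrite /= mul1g invg1 mulg1. Qed.

Fact conj_reflectionM v w t :
  conj_reflection (v * w) t = conj_reflection v (conj_reflection w t).
Proof. by apply: val_inj; rewrite /= invgM !mulgA. Qed.

Fact conj_reflectionK w : cancel (conj_reflection w) (conj_reflection w^-1).
Proof. by move=> t; rewrite -conj_reflectionM mulVg conj_reflection1. Qed.

Fact conj_mapE w (A : set T) t : conj_map w A t = A (conj_reflection w^-1 t).
Proof.
apply/propext; split=> [[u Au <-]|At]; first by rewrite conj_reflectionK.
exists (conj_reflection w^-1 t) => //.
by rewrite -{1}(invgK w) conj_reflectionK.
Qed.

Fact conj_map_morph w : boolean_ring_morphism (conj_map w).
Proof.
split=> A B; apply/funext => t; rewrite conj_mapE.
  change ((A `+` B) (conj_reflection w^-1 t) =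
          (conj_map w A `+` conj_map w B) t).
  by rewrite /setY /setU /setD /mkset !conj_mapE.
change ((A `&` B) (conj_reflection w^-1 t) = (conj_map w A `&` conj_map w B) t).
by rewrite /setI /mkset !conj_mapE.
Qed.

Fact conj_map1 (A : set T) : conj_map 1 A = A.
Proof. by apply/funext => t; rewrite conj_mapE invg1 conj_reflection1. Qed.

Fact conj_mapM v w (A : set T) : conj_map (v * w) A = conj_map v (conj_map w A).
Proof.
by apply/funext => t; rewrite !conj_mapE invgM conj_reflectionM.
Qed.

Definition standard_functor : boolean_functor (group_groupoid W) :=
  @BooleanFunctor (group_groupoid W) (fun _ => set T : booleanRingType)
    (fun _ _ => conj_map) (fun _ _ => conj_map_morph)
    (fun _ => conj_map1) (fun _ _ _ => conj_mapM).

Definition inversion_set (w : W) : set T :=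
  [set t | (coxeter_length S (val t * w) < coxeter_length S w)%N].

Definition standard_rootoid : triple :=
  @Triple (group_groupoid W) standard_functor (fun _ _ => inversion_set).

End StandardRootoid.

Arguments inversion_set {W} S w.

(* Main.v *)
Require Import Defs.
From HB Require Import structures.
From mathcomp Require Import all_boot ssralg all_classical.

(* The universal property of the presentation, applied to a semidirect product,
   yields the reflection cocycle N; the exchange property identifies it with the
   inversion sets of the length function. In terms of N, l(xy) = l(x) + l(y) iff
   N(x^-1) and N(y) are disjoint, and x <= xy under the same condition.
   For a fixed y, the elements z <= x with N(z) and N(y) disjoint are
   closed under joins, by climbing along covers and reducing to dihedral
   parabolic subgroups. The case y = 1 gives bounded joins, hence all meets, and
   the general case is the JOP.
   Automorphisms of (W,S) preserve the weak order, so joins and meets of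
   G-stable sets are fixed; the join of the G-orbit of w is theta^perp(w), and
   the AOP is the JOP for this join. If g in W^G has a descent s, the
   whole orbit J of s consists of descents of g; then W_J is finite and its longest element
   is fixed and lies below g, which determines the atoms. If no element of an
   orbit J is a descent of g, then N(w_J) and N(g) are disjoint. *)

Set Implicit Arguments.
Unset Strict Implicit.
Unset Printing Implicit Defensive.

Local Open Scope classical_set_scope.
Local Open Scope group_scope.

(* The semidirect product of the power set of [W] (under symmetric difference)
   by [W] acting by conjugation. *)
Definition signed_group (W : groupType) : Type := ((W -> bool) * W)%type.

Section SignedGroup.
Variable W : groupType.
Implicit Types p q r : signed_group W.

HB.instance Definition _ := Choice.on (signed_group W).

Definition sg_one : signed_group W := (fun=> false, 1).
Definition sg_inv p : signed_group W := (fun t => p.1 (t ^ p.2^-1), p.2^-1).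
Definition sg_mul p q : signed_group W :=
  (fun t => p.1 t (+) q.1 (t ^ p.2), p.2 * q.2).

Fact sg_mulA : associative sg_mul.
Proof.
move=> p q r; congr pair; last exact: mulgA.
by apply/funext => t /=; rewrite addbA conjgM.
Qed.

Fact sg_mul1 : left_id sg_one sg_mul.
Proof. by case=> A w; congr pair; [apply/funext=> t /=; rewrite conjg1|
  exact: mul1g]. Qed.

Fact sg_mulr1 : right_id sg_one sg_mul.
Proof. by case=> A w; congr pair; [apply/funext=> t /=; rewrite addbF|
  exact: mulg1]. Qed.

Fact sg_mulV : left_inverse sg_one sg_inv sg_mul.
Proof. by case=> A w; congr pair; [apply/funext=> t /=; rewrite addbb|
  exact: mulVg]. Qed.

Fact sg_mulrV : right_inverse sg_one sg_inv sg_mul.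
Proof.
by case=> A w; congr pair; [apply/funext=> t /=; rewrite conjgK addbb|
  exact: mulgV].
Qed.

HB.instance Definition _ := isGroup.Build (signed_group W)
  sg_mulA sg_mul1 sg_mulr1 sg_mulV sg_mulrV.

End SignedGroup.

(** * The reflection cocycle, from the presentation *)

Section Presentation.
Variables (W : groupType) (S : set W).
Hypothesis cox : coxeter_system S.

Lemma genxx s : S s -> s * s = 1.
Proof. by case: cox => + _ _ => /[apply]-[]. Qed.

Lemma genV s : S s -> s^-1 = s.
Proof. by move=> Ss; apply: mulg1_eq; rewrite genxx. Qed.

(** Inverting (st)^n gives (ts)^n, so both sides spell the same alternating word of length 2n +
    1. *)
Lemma gen_dihedral s t n : S s -> S t ->
  s * (s * t) ^- n = (s * t) ^+ n * s.
Proof.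
move=> Ss St; rewrite -expVgn invgM !genV //; elim: n => [|n IHn].
  by rewrite mulg1 mul1g.
by rewrite !expgSr mulgA IHn -!mulgA.
Qed.

Definition sg_gen (s : W) : signed_group W := (fun t => t == s, s).

(* If (st)^n = 1 the reflections (st)^j s, j < 2n, cancel in pairs, so that
   s |-> ({s}, s) satisfies the relations of the presentation. *)
Lemma sg_gen_expg s t n : S s -> S t ->
  (sg_gen s * sg_gen t) ^+ n =
  (fun r => \big[addb/false]_(0 <= j < n.*2) (r == (s * t) ^+ j * s),
   (s * t) ^+ n).
Proof.
move=> Ss St; elim: n => [|n IHn].
  by congr pair; apply/funext => r; rewrite big_nil.
rewrite expgSr IHn; congr pair; last by rewrite expgSr.
apply/funext => r; rewrite doubleS !big_nat_recr//= -addbA; congr addb.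
congr addb.
  rewrite (can2_eq (conjgK _) (conjgKV _)) conjgE invgK gen_dihedral //.
  by rewrite mulgA -expgnDr addnn.
rewrite /= -conjgM (can2_eq (conjgK _) (conjgKV _)) conjgE invgK invgM genV //.
by rewrite -!mulgA gen_dihedral // !mulgA -(mulgA _ s t) -expgSr -expgnDr addSn
  addnn.
Qed.

Lemma subgroup_generated_ind (J : set W) (P : W -> Prop) :
  P 1 -> (forall x y, P x -> P y -> P (x * y)) -> (forall x, P x -> P x^-1) ->
  (forall s, J s -> P s) -> forall w, subgroup_generated J w -> P w.
Proof. by move=> P1 PM PV PJ w; apply: (@smallest_sub _ _ J P). Qed.

(** [N] is the first component of the homomorphism into [signed_group]; its second component is w
    itself, which turns the product rule into the cocycle identity. *)
Lemma exists_cocycle : exists N : W -> W -> bool,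
  (forall x y t, N (x * y) t = N x t (+) N y (t ^ x)) /\
  (forall s t, S s -> N s t = (t == s)).
Proof.
case: (cox) => _ genW /(_ _ sg_gen)[s t n Ss St|phi phiS].
  move=> st1; rewrite sg_gen_expg // st1.
  congr pair; apply/funext => r.
  rewrite -addnn (@big_cat_nat _ _ _ n) ?leq_addr //=.
  rewrite -{2}[n]add0n big_addn addnK.
  under [X in _ (+) X]eq_bigr do rewrite expgnDr st1 mulg1.
  by rewrite addbb.
have phi2 w : (phi w).2 = w.
  have: subgroup_generated S w by rewrite genW.
  move: w; apply: subgroup_generated_ind => [|x y xE yE|x xE|s Ss].
  - by rewrite /= multiplicative1.
  - by rewrite /= gmulfM /= xE yE.
  - apply/esym/mulg1_eq;
      rewrite -{1}xE -[RHS](congr1 snd (multiplicative1 phi)).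
    by rewrite -(mulgV x) gmulfM.
  - by rewrite phiS.
exists (fun w => (phi w).1); split=> [x y t|s t Ss]; last by rewrite phiS.
by rewrite gmulfM /= phi2.
Qed.

(** * Words, length and exchange *)

Lemma sub_gen (J : set W) s : J s -> subgroup_generated J s.
Proof. exact: sub_gen_smallest. Qed.

Lemma subgroup_generated_subgroup (J : set W) :
  is_subgroup (subgroup_generated J).
Proof.
split=> [A [[]]//|x y Jx Jy A [sA JA]|x Jx A [sA JA]].
  by case: (sA) => _ + _; apply; [exact: (Jx A (conj sA JA))|
    exact: (Jy A (conj sA JA))].
by case: (sA) => _ _; apply; exact: (Jx A (conj sA JA)).
Qed.

Lemma prod_rev_gen ss : (forall s, s \in ss -> S s) ->
  \prod_(s <- rev ss) s = (\prod_(s <- ss) s)^-1.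
Proof.
move=> Sss; rewrite -[LHS]invgK -prodgV; congr _^-1.
by apply: eq_big_seq => s /Sss/genV.
Qed.

Lemma generated_expression (J : set W) w : (forall s, J s -> S s) ->
  subgroup_generated J w -> exists ss, is_expression J w ss.
Proof.
move=> JS; move: w; apply: subgroup_generated_ind =>
  [|x y [xs [Jxs ->]] [ys [Jys ->]]|x [xs [Jxs ->]]|s Js].
- by exists [::]; split=> //; rewrite big_nil.
- exists (xs ++ ys); split=> [s|]; rewrite ?big_cat // mem_cat.
  by case/orP; [apply: Jxs|apply: Jys].
- exists (rev xs); split=> [s|]; first by rewrite mem_rev; apply: Jxs.
  by rewrite prod_rev_gen // => s /Jxs/JS.
- by exists [:: s]; split=> [r|]; rewrite ?big_seq1 // inE => /eqP->.
Qed.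

Lemma expression_exists w : exists ss, is_expression S w ss.
Proof. by apply: generated_expression => //; case: cox => _ -> _. Qed.

Local Notation l := (coxeter_length S).

Lemma minimal_expression (J : set W) w :
  (exists ss, is_expression J w ss) ->
  exists2 ss, is_expression J w ss &
    forall ss', is_expression J w ss' -> (size ss <= size ss')%N.
Proof.
move=> [ss0 e0];
  pose P n := `[< exists2 ss, is_expression J w ss & size ss = n >].
have exP : exists n, P n by exists (size ss0); apply/asboolP; exists ss0.
case: (ex_minnP exP) => _ /asboolP[ss e <-] min_ss.
by exists ss => // ss' e'; apply: min_ss; apply/asboolP; exists ss'.
Qed.

Lemma coxeter_lengthP w :
  (exists2 ss, is_expression S w ss & size ss = l w) /\
  (forall ss, is_expression S w ss -> (l w <= size ss)%N).
Proof.
have [ss e min_ss] := minimal_expression (expression_exists w).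
rewrite /coxeter_length; set P := (X in xget _ X).
have : P (xget 0%N P) by apply: xgetPex; exists (size ss); split=> //;
  exists ss.
by [].
Qed.

Lemma length_eq0 w : l w = 0%N -> w = 1.
Proof.
by case: (coxeter_lengthP w) => [[ss [_ ->] <-] _] /size0nil ->;
  rewrite big_nil.
Qed.

Lemma length_genM s w : S s -> (l (s * w) <= (l w).+1)%N.
Proof.
move=> Ss; have [[ss [Sss ->] <-] _] := coxeter_lengthP w.
have [_ le_l] := coxeter_lengthP (s * \prod_(r <- ss) r).
apply: (le_l (s :: ss)); split=> [r|]; last by rewrite big_cons.
by rewrite inE => /predU1P[->//|/Sss].
Qed.

Lemma cocycle1 (N : W -> W -> bool) t :
  (forall x y t, N (x * y) t = N x t (+) N y (t ^ x)) -> N 1 t = false.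
Proof. by move/(_ 1 1 t); rewrite mul1g conjg1 addbb. Qed.

(** Induction along the word: either t is the first letter s, which is deleted, or t^s is inverted
    by the rest. [N] is arbitrary because the lemma serves to identify it with [inverts]; the
    letters stay in [J] for the parabolic case. *)
Lemma cocycle_exchange (N : W -> W -> bool) (J : set W) w t ss :
  (forall x y t, N (x * y) t = N x t (+) N y (t ^ x)) ->
  (forall s t, S s -> N s t = (t == s)) -> (forall s, J s -> S s) ->
  is_expression J w ss -> N w t ->
  exists2 ss', is_expression J (t * w) ss' & (size ss' < size ss)%N.
Proof.
move=> NM Ngen JS; elim: ss w t => [|s ss IHss] w t [Jss ->].
  by rewrite big_nil (cocycle1 _ NM).
have Js : J s by apply/Jss/mem_head.
have {}Jss r : r \in ss -> J r by move=> rss; apply: Jss; rewrite inE rss orbT.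
rewrite big_cons NM Ngen; last exact: JS.
case: eqP => [-> _|_ /=].
  by exists ss => //; split=> //; rewrite mulgA genxx ?mul1g //; apply: JS.
case/(IHss _ _ (conj Jss erefl)) => ss' [Jss' E] lt_ss'.
exists (s :: ss') => //; split=> [r|]; first
  by rewrite inE => /predU1P[->|/Jss'].
by rewrite big_cons -E conjgE !mulgA mulgV mul1g.
Qed.

(** * Inversion sets, descents and parabolic subgroups *)

(** A boolean on all of W, false off the reflections, so that the cocycle identity becomes an
    exclusive or that avoids the subtype of reflections. *)
Definition inverts w t : bool := `[< reflections S t >] && (l (t * w) < l w)%N.

(** Exchange puts N(w) inside the inversion set. Conversely, a reflection t lies in N(t), so if it
    is outside N(w) it lies in N(tw), and l(w) < l(tw). *)
Lemma cocycle_inverts (N : W -> W -> bool) :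
  (forall x y t, N (x * y) t = N x t (+) N y (t ^ x)) ->
  (forall s t, S s -> N s t = (t == s)) -> forall w t, inverts w t = N w t.
Proof.
move=> NM Ngen.
have N1 t := cocycle1 t NM.
have Nlt w t : N w t -> (l (t * w) < l w)%N.
  move=> Nwt; have [[ss ess <-] _] := coxeter_lengthP w.
  have [ss' ess' lt_ss'] := cocycle_exchange NM Ngen (fun _ => id) ess Nwt.
  by apply: leq_ltn_trans lt_ss'; have [_] := coxeter_lengthP (t * w); apply.
have Nrefl w t : N w t -> reflections S t.
  have [ss [Sss ->]] := expression_exists w.
  elim: ss Sss t => [|s ss IHss] Sss t; first by rewrite big_nil N1.
  rewrite big_cons NM Ngen; last exact/Sss/mem_head.
  case: eqP => [-> _|_ /= /IHss[r rss|u [v Sv E]]].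
  - by exists 1, s; [apply/Sss/mem_head|rewrite mul1g invg1 mulg1].
  - by apply: Sss; rewrite inE rss orbT.
  - exists (s * u), v => //.
    by rewrite -[LHS](conjgK s) E conjgE invgM invgK !mulgA.
(* In the expansion of N(w s w^-1) at t the outer terms cancel, because N(w w^-1) vanishes; N(s) at
   s is left. *)
have Ntt t : reflections S t -> N t t.
  move=> [w [s Ss tE]].
  have tw : t ^ w = s by rewrite tE conjgE !mulgA mulVg mul1g mulgVK.
  rewrite {1}tE !NM (Ngen s) // tw eqxx conjgM tw conjgE (genV Ss) (genxx Ss)
    mulg1.
  have := NM w w^-1 t; rewrite mulgV N1 tw.
  by case: (N w t); case: (N w^-1 s).
have reflxx t : reflections S t -> t * t = 1.
  move=> [w [s Ss ->]].
  by rewrite !mulgA mulgVK -(mulgA w) genxx // mulg1 mulgV.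
move=> w t; apply/andP/idP => [[/asboolP Rt]|Nwt]; last first.
  by split; [apply/asboolP; exact: Nrefl Nwt|exact: Nlt].
apply: contraLR => nNwt; rewrite -leqNgt ltnW // -[X in (l X < _)%N](mul1g w).
by rewrite -(reflxx t Rt) -mulgA Nlt // NM Ntt // conjgE mulKg (negPf nNwt).
Qed.

Lemma invertsM x y t : inverts (x * y) t = inverts x t (+) inverts y (t ^ x).
Proof.
by have [N [NM Ngen]] := exists_cocycle; rewrite !(cocycle_inverts NM Ngen).
Qed.

Lemma inverts_gen s t : S s -> inverts s t = (t == s).
Proof.
have [N [NM Ngen]] := exists_cocycle; rewrite (cocycle_inverts NM Ngen).
exact: Ngen.
Qed.

Definition exchange J w t ss :=
  @cocycle_exchange inverts J w t ss invertsM inverts_gen.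

Lemma inverts1 t : inverts 1 t = false.
Proof. exact: cocycle1 invertsM. Qed.

Lemma invertsV w t : inverts w^-1 t = inverts w (t ^ w^-1).
Proof.
have := invertsM w^-1 w t; rewrite mulVg inverts1.
by case: (inverts w^-1 t); case: (inverts w _).
Qed.

Lemma inverts_lt w t : inverts w t -> (l (t * w) < l w)%N.
Proof. by case/andP. Qed.

Lemma length_ascent s w : S s -> ~~ inverts w s -> l (s * w) = (l w).+1.
Proof.
move=> Ss nws; apply/eqP; rewrite eqn_leq length_genM //=.
have : inverts (s * w) s.
  by rewrite invertsM inverts_gen // eqxx conjgE mulKg (negPf nws).
by move/inverts_lt; rewrite mulgA genxx // mul1g.
Qed.

Lemma length_descent s w : S s -> inverts w s -> l w = (l (s * w)).+1.
Proof.
move=> Ss ws; rewrite -(@length_ascent s (s * w)) // ?mulgA ?genxx ?mul1g //.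
by rewrite invertsM inverts_gen // eqxx conjgE mulKg ws.
Qed.

(** Among elements of W_J, the property is closed under products and inverses by the cocycle
    identity, since W_J is stable under conjugation by its elements. *)
Lemma parabolic_inverts (J : set W) w t : (forall s, J s -> S s) ->
  subgroup_generated J w -> inverts w t -> subgroup_generated J t.
Proof.
move=> JS; have [J1 JM JV] := subgroup_generated_subgroup J.
have JJ x y : subgroup_generated J x -> subgroup_generated J (y ^ x) ->
    subgroup_generated J y.
  move=> Jx Jyx; rewrite -(conjgK x y); rewrite conjgE.
  exact: (JM _ _ (JV _ (JV _ Jx)) (JM _ _ Jyx (JV _ Jx))).
move=> Jw wt; suff [_] : subgroup_generated J w /\
    forall t, inverts w t -> subgroup_generated J t by apply.
move: {t wt} w Jw; apply: subgroup_generated_ind.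
- by split=> // u; rewrite inverts1.
- move=> x y [Jx xJ] [Jy yJ]; split=> [|u]; first exact: JM.
  by rewrite invertsM; case: (boolP (inverts x u)) => [/xJ//|_ /yJ]; apply: JJ.
- move=> x [Jx xJ]; split=> [|u]; first exact: JV.
  by rewrite invertsV => /xJ; apply: JJ; exact: JV.
- move=> s Js; split=> [|u]; first exact: sub_gen.
  by rewrite inverts_gen => [/eqP->|]; [exact: sub_gen|exact: JS].
Qed.

(** The first letter s of a minimal word in [J] is a descent: if w did not invert s, then sw would,
    and exchange in sw would give a shorter word for w. *)
Lemma parabolic_descent (J : set W) w : (forall s, J s -> S s) ->
  subgroup_generated J w -> w <> 1 -> exists2 s, J s & inverts w s.
Proof.
move=> JS /(generated_expression JS)/minimal_expression[[|s ss] ew min_ss].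
  by case: ew => _ ->; rewrite big_nil.
move=> _; have Js : J s by case: ew => + _; apply; exact: mem_head.
exists s => //; apply/negPn/negP => nws.
case: (ew) => Jss E.
have ess : is_expression J (s * w) ss.
  split=> [r rss|]; first by apply: Jss; rewrite inE rss orbT.
  by rewrite E big_cons mulgA genxx ?mul1g //; apply: JS.
have sws : inverts (s * w) s.
  by rewrite invertsM inverts_gen ?eqxx ?conjgE ?mulKg ?(negPf nws) //;
    exact: JS.
have [ss' ess' lt_ss'] := exchange JS ess sws.
have /min_ss : is_expression J w ss'.
  by rewrite -[w]mul1g -(@genxx s) -?mulgA //; exact: JS.
by rewrite leqNgt ltnS ltnW.
Qed.

Lemma gen_parabolic (J : set W) s : (forall r, J r -> S r) -> S s ->
  subgroup_generated J s -> J s.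
Proof.
move=> JS Ss /(parabolic_descent JS)[|r Jr]; last first.
  by rewrite inverts_gen // => /eqP<-.
by case: cox => /(_ _ Ss)[].
Qed.

Lemma length1 : l 1 = 0%N.
Proof.
have [_ /(_ [::])] := coxeter_lengthP 1; rewrite leqn0 => E.
by apply/eqP/E; split=> //; rewrite big_nil.
Qed.

Lemma descent_exists w : w <> 1 -> exists2 s, S s & inverts w s.
Proof.
apply: parabolic_descent => //; rewrite /subgroup_generated.
by case: cox => _; rewrite /subgroup_generated => -> _.
Qed.

Lemma lengthV w : l w^-1 = l w.
Proof.
suff le x : (l x^-1 <= l x)%N.
  by apply/eqP; rewrite eqn_leq le -{1}(invgK w) le.
have [[ss [Sss ->] <-] _] := coxeter_lengthP x.
have [_] := coxeter_lengthP (\prod_(s <- ss) s)^-1.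
rewrite -(size_rev ss); apply; split=> [s|]; first by rewrite mem_rev;
  apply: Sss.
by rewrite prod_rev_gen.
Qed.

Lemma length_mul x y : (l (x * y) <= l x + l y)%N.
Proof.
have [[xs [Sxs ->] <-] _] := coxeter_lengthP x.
have [[ys [Sys ->] <-] _] := coxeter_lengthP y.
rewrite -size_cat -big_cat /=; have [_] :=
  coxeter_lengthP (\prod_(s <- xs ++ ys) s).
by apply; split=> // s; rewrite mem_cat => /orP[/Sxs|/Sys].
Qed.

Lemma inverts_sq w t : inverts w t -> t * t = 1.
Proof.
case/andP=> /asboolP[u [s Ss ->]] _.
by rewrite !mulgA mulgVK -(mulgA u) genxx // mulg1 mulgV.
Qed.

(** Peeling off one letter, N(sw) is contained in {s} together with the conjugate of N(w) by s. The
    list is used for the finiteness of intervals. *)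
Lemma inverts_seq w : exists ts : seq W, forall t, inverts w t -> t \in ts.
Proof.
have [ss [Sss ->]] := expression_exists w.
elim: ss Sss => [|s ss IHss] Sss.
  by exists [::] => t; rewrite big_nil inverts1.
have [|ts tsP] := IHss; first by move=> r rss; apply: Sss; rewrite inE rss orbT.
exists (s :: [seq t ^ s^-1 | t <- ts]) => t; rewrite big_cons invertsM.
rewrite inverts_gen; last exact/Sss/mem_head.
rewrite inE; case: eqP => //= _ /tsP tss.
by rewrite -(conjgK s t); apply: (map_f (fun u => u ^ s^-1)).
Qed.

(** * The weak order and its relation to length *)

Definition weak_le x y := forall t, inverts x t -> inverts y t.
Definition weak_orth x y := forall t, inverts x t -> ~~ inverts y t.

Lemma weak_le_trans y x z : weak_le x y -> weak_le y z -> weak_le x z.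
Proof. by move=> xy yz t /xy/yz. Qed.

Lemma weak_le1 x : weak_le 1 x.
Proof. by move=> t; rewrite inverts1. Qed.

Lemma weak_orth_sym x y : weak_orth x y -> weak_orth y x.
Proof. by move=> xy t; apply: contraL => /xy. Qed.

Lemma weak_le_orth x y z : weak_le x y -> weak_orth y z -> weak_orth x z.
Proof. by move=> xy yz t /xy/yz. Qed.

Lemma weak_le_gen s w : S s -> inverts w s -> weak_le s w.
Proof. by move=> Ss ws t; rewrite inverts_gen // => /eqP->. Qed.

Lemma weak_orth_gen s w : S s -> ~~ inverts w s -> weak_orth s w.
Proof. by move=> Ss ws t; rewrite inverts_gen // => /eqP->. Qed.

Lemma inverts_orthM x y t : weak_orth x^-1 y ->
  inverts (x * y) t = inverts x t || inverts y (t ^ x).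
Proof.
move=> xy; rewrite invertsM; case: (boolP (inverts x t)) => //= xt.
by apply/xy; rewrite invertsV conjgK.
Qed.

(** By the cocycle identity, t in N(x) survives in N(xy) exactly when t^x is not in N(y), and t^x
    runs over N(x^-1). *)
Lemma weak_leMP x y : weak_le x (x * y) <-> weak_orth x^-1 y.
Proof.
split=> [xy t|xy t xt]; last by rewrite inverts_orthM // xt.
by rewrite invertsV => xt; have := xy _ xt; rewrite invertsM xt conjgKV.
Qed.

Lemma weak_leP x y : weak_le x y <-> weak_orth x^-1 (x^-1 * y).
Proof. by rewrite -weak_leMP mulVKg. Qed.

(** Under the hypotheses N(zx) is the disjoint union of N(z) and the conjugate of N(x) by z, and
    likewise for y. *)
Lemma weak_leM2l z x y : weak_orth z^-1 x -> weak_orth z^-1 y ->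
  weak_le (z * x) (z * y) <-> weak_le x y.
Proof.
move=> zx zy; split=> xy t; last first.
  by rewrite !inverts_orthM // => /orP[->//|/xy->]; rewrite orbT.
move=> xt; have := xy (t ^ z^-1); rewrite !inverts_orthM // conjgKV xt orbT.
by move=> /(_ isT)/orP[]//; rewrite -invertsV => /zx; rewrite xt.
Qed.

(** If t lies in both sets, then xy = (xt)(ty) with shorter factors, so the lengths do not add up.
    Conversely, the last letters of x are moved one by one to the front of y, which grows by one
    each time. *)
Lemma weak_orth_length x y : weak_orth x^-1 y <-> l (x * y) = (l x + l y)%N.
Proof.
split=> [|E t xt]; last first.
  apply/negP => yt; have := length_mul (x * t) (t * y).
  rewrite leqNgt -mulgA (mulgA t) (inverts_sq xt) mul1g E => /negP; apply.
  rewrite -[l (x * t)]lengthV -[l x]lengthV -addSn.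
  rewrite leq_add ?(ltnW (inverts_lt yt)) //.
  by rewrite invgM (mulg1_eq (inverts_sq xt)) inverts_lt.
have [n] := ubnP (l x); elim: n x y => // n IHn x y /[!ltnS] len xy.
have [->|/eqP x1] := eqVneq x 1; first by rewrite mul1g length1.
have [|s Ss xs] := @descent_exists x^-1; first by rewrite -invg1 => /invg_inj.
have lx : l x = (l (x * s)).+1.
  by rewrite -lengthV (length_descent Ss xs) -lengthV invgM invgK genV.
have -> : x * y = (x * s) * (s * y) by rewrite -mulgA (mulgA s) genxx ?mul1g.
rewrite IHn; first by rewrite (length_ascent Ss (xy _ xs)) lx addSnnS.
  by rewrite -ltnS -lx ltnS.
move=> t; rewrite invgM genV // !invertsM !(inverts_gen _ Ss).
by case: eqP => [->|_] /=; [rewrite conjgE mulKg xs|exact: xy].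
Qed.

Lemma weak_le_lengthP x y : weak_le x y <-> l y = (l x + l (x^-1 * y))%N.
Proof. by rewrite weak_leP weak_orth_length mulVKg. Qed.

Lemma weak_le_length x y : weak_le x y -> (l x <= l y)%N.
Proof. by move/weak_le_lengthP->; exact: leq_addr. Qed.

Lemma weak_le_eq x y : weak_le x y -> (l y <= l x)%N -> x = y.
Proof.
move=> /weak_le_lengthP->; rewrite -[leqRHS]addn0 leq_add2l leqn0.
by move=> /eqP/length_eq0/mulg1_eq; rewrite invgK.
Qed.

Lemma weak_le_anti x y : weak_le x y -> weak_le y x -> x = y.
Proof. by move=> xy /weak_le_length; exact: weak_le_eq. Qed.

(** An element below w is determined by which members of a finite list containing N(w) it
    inverts. *)
Lemma weak_interval_finite w : finite_set [set x | weak_le x w].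
Proof.
have [ts tsP] := inverts_seq w.
pose f x := [ffun i : 'I_(size ts) => inverts x (nth 1 ts i)].
have f_inj : {in [set x | weak_le x w] &, injective f}.
  have fP x y : weak_le x w -> f x = f y -> weak_le x y.
    move=> xw /ffunP fxy t xt; have tts := tsP _ (xw _ xt).
    move: tts (tts); rewrite -{1}index_mem => lt_t tts.
    by have := fxy (Ordinal lt_t); rewrite !ffunE /= nth_index // xt.
  move=> x y /set_mem xw /set_mem yw fxy.
  by apply: weak_le_anti; apply: fP.
by rewrite -(eq_finite_set (inj_card_eq f_inj)); exact: finite_finset.
Qed.

(** * Parabolic subgroups in the weak order *)

(* [m] is the element of minimal length of its coset W_J m. *)
Lemma weak_orth_parabolic (J : set W) m v : (forall s, J s -> S s) ->
  (forall s, J s -> ~~ inverts m s) -> subgroup_generated J v -> weak_orth v m.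
Proof.
move=> JS mJ Jv; have [J1 JM JV] := subgroup_generated_subgroup J.
pose P n := `[< exists2 u, subgroup_generated J u & l (u * m) = n >].
have exP : exists n, P n by exists (l (1 * m)); apply/asboolP; exists 1.
case: (ex_minnP exP) => _ /asboolP[u Ju <-] min_um.
(* Minimality of l(um) in the coset gives the claim for um. It remains to see that u = 1: a descent
   of u^-1 in [J] would be inverted by m = u^-1 (um). *)
have um_orth v' : subgroup_generated J v' -> weak_orth v' (u * m).
  move=> Jv' t v't; apply/negP => /inverts_lt; rewrite ltnNge => /negP; apply.
  apply: min_um; apply/asboolP; exists (t * u); last by rewrite mulgA.
  by apply: JM => //; exact: parabolic_inverts Jv' v't.
have [u1|/eqP u1] := eqVneq u 1; first by rewrite -(mul1g m) -{1}u1;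
  exact: um_orth.
have [||s Js us] := @parabolic_descent J u^-1 JS.
- exact: JV.
- by rewrite -invg1 => /invg_inj.
have /negP[] := mJ s Js.
rewrite -(mulKg u m) inverts_orthM ?us //.
by rewrite invgK; exact: um_orth.
Qed.

(* Write u = a u' with a in J and u' < u, and p = u' w'. As a is in N(p) but not
   in N(u'), the reflection t = u'^-1 a u' is in N(w'), so p = u (t w') with
   l(t w') < l(w'), and the lengths must add up. *)
Lemma weak_le_parabolic (J : set W) p u : (forall s, J s -> S s) ->
  (forall s, J s -> inverts p s) -> subgroup_generated J u -> weak_le u p.
Proof.
move=> JS pJ; have [J1 JM JV] := subgroup_generated_subgroup J.
have [n] := ubnP (l u); elim: n u => // n IHn u /[!ltnS] len Ju.
have [->|/eqP u1] := eqVneq u 1; first exact: weak_le1.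
have [a Ja ua] := parabolic_descent JS Ju u1; have Sa := JS a Ja.
have lu := length_descent Sa ua.
have uE : u = a * (a * u) by rewrite mulgA genxx ?mul1g.
have /IHn : (l (a * u) < n)%N by rewrite -lu.
move=> /(_ (JM _ _ (sub_gen Ja) Ju))/weak_le_lengthP lp.
apply/weak_le_lengthP/eqP; rewrite eqn_leq -{1}(mulVKg u p) length_mul /= lp lu.
rewrite addSn -addnS leq_add2l.
have : inverts ((a * u)^-1 * p) (a ^ (a * u)).
  have := pJ a Ja; rewrite -{1}(mulVKg (a * u) p) invertsM.
  by rewrite invertsM inverts_gen // eqxx conjgE mulKg ua.
move/inverts_lt; congr (_ < _)%N; congr l.
by rewrite [in RHS]uE !conjgE !invgM !mulgA !mulgVK (genV Sa) mulgK.
Qed.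

(** Every element of W_J lies below v, so l(v) bounds the lengths on W_J and a longest p exists; by
    maximality each s in [J] is a descent of p. *)
Lemma longest_parabolic (J : set W) v : (forall s, J s -> S s) ->
  (forall s, J s -> inverts v s) ->
  exists p, [/\ subgroup_generated J p, forall s, J s -> inverts p s &
                weak_le p v].
Proof.
move=> JS vJ; have [J1 JM _] := subgroup_generated_subgroup J.
pose P n := `[< exists2 u, subgroup_generated J u & l u = n >].
have exP : exists n, P n by exists (l 1); apply/asboolP; exists 1.
have ubP n : P n -> (n <= l v)%N.
  by case/asboolP=> u Ju <-; apply/weak_le_length/(weak_le_parabolic JS).
case: (ex_maxnP exP ubP) => _ /asboolP[p Jp <-] max_p; exists p; split=> //.
  move=> s Js; apply/negPn/negP => /(length_ascent (JS s Js)) lsp.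
  suff /max_p : P (l (s * p)) by rewrite lsp ltnn.
  by apply/asboolP; exists (s * p) => //; apply: JM => //; exact: sub_gen.
exact: weak_le_parabolic vJ Jp.
Qed.

(** * Bounded joins, orthogonality of joins, and meets *)

Lemma weak_cover z y : weak_le z y -> z <> y ->
  exists a, [/\ S a, ~~ inverts z^-1 a & weak_le (z * a) y].
Proof.
move=> zy zney; have [|a Sa ya] := @descent_exists (z^-1 * y).
  by move/mulg1_eq; rewrite invgK.
have /weak_leP zyo := zy; exists a; split=> //.
  by apply: contraL ya => /zyo.
rewrite -(mulVKg z y); apply/weak_leM2l => //; last exact: weak_le_gen.
by apply/weak_orth_sym/weak_orth_gen => //; apply: contraL ya => /zyo.
Qed.

(* Covers z a and z b of a common lower bound z have the join z p, p being the
   longest element of the dihedral subgroup of a and b; one then moves up from z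
   to z a and z b. *)
Lemma weak_join2 x y y1 y2 :
  weak_le y1 x -> weak_orth y1 y -> weak_le y2 x -> weak_orth y2 y ->
  exists j, [/\ weak_le j x, weak_orth j y, weak_le y1 j, weak_le y2 j &
    forall v, weak_le y1 v -> weak_le y2 v -> weak_le j v].
Proof.
(* The induction is on l(x) - l(z) for a varying common lower bound z; the claim is the case z =
   1. *)
suff gen n z : (l x - l z < n)%N -> weak_le z y1 -> weak_le z y2 ->
  weak_le y1 x -> weak_orth y1 y -> weak_le y2 x -> weak_orth y2 y ->
  exists j, [/\ weak_le j x, weak_orth j y, weak_le y1 j, weak_le y2 j &
    forall v, weak_le y1 v -> weak_le y2 v -> weak_le j v].
  by apply: (gen _ 1); [exact: ltnSn|exact: weak_le1|exact: weak_le1].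
elim: n z y1 y2 => // n IHn z y1 y2 /[!ltnS] len zy1 zy2 y1x y1y y2x y2y.
have [E|/eqP zney1] := eqVneq z y1; first by exists y2; split; rewrite -?E.
have [E|/eqP zney2] := eqVneq z y2; first by exists y1; split; rewrite -?E.
have zx := weak_le_trans zy1 y1x.
have [a [Sa za ay1]] := weak_cover zy1 zney1.
have [b [Sb zb by2]] := weak_cover zy2 zney2.
pose J := [set a; b].
have JS c : J c -> S c by case=> ->.
have Jz c : J c -> ~~ inverts z^-1 c by case=> ->.
have zJ_orth c : J c -> weak_orth z^-1 c.
  by move=> Jc; apply/weak_orth_sym/weak_orth_gen; [exact: JS|exact: Jz].
have JP c : J c -> weak_le (z * c) x /\ weak_orth (z * c) y.
  case=> ->; split; [exact: weak_le_trans y1x|exact: weak_le_orth y1y|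
                     exact: weak_le_trans y2x|exact: weak_le_orth y2y].
have lJ c : J c -> (l x - l (z * c) < n)%N.
  move=> Jc; have lzc : l (z * c) = (l z).+1.
    have -> : l (z * c) = l (c * z^-1)
      by rewrite -lengthV invgM (genV (JS _ Jc)).
    by rewrite (length_ascent (JS _ Jc) (Jz _ Jc)) lengthV.
  apply: leq_trans len; rewrite lzc; apply: ltn_sub2l => //.
  by rewrite -lzc; apply/weak_le_length; case: (JP c Jc).
have le_lift v c : weak_le z v -> J c -> weak_le (z * c) v ->
  inverts (z^-1 * v) c.
  move=> zv Jc zcv; suff : weak_le c (z^-1 * v).
    by apply; rewrite inverts_gen ?eqxx //; exact: JS.
  apply/(@weak_leM2l z); [exact: zJ_orth|exact/weak_leP|by rewrite mulVKg].
have [p [Jp pJ px]] : exists p, [/\ subgroup_generated J p,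
    forall s, J s -> inverts p s & weak_le p (z^-1 * x)].
  apply: longest_parabolic => // c Jc.
  by apply: le_lift => //; case: (JP c Jc).
have zp : weak_orth z^-1 p.
  exact/weak_orth_sym/(weak_orth_parabolic JS).
have zpx : weak_le (z * p) x.
  by rewrite -(mulVKg z x); apply/weak_leM2l => //; exact/weak_leP.
have zyo : weak_orth z y := weak_le_orth zy1 y1y.
(* N(zp) is N(z) together with the conjugate of N(p) by z. For the second part, neither [a] nor [b]
   is a descent of z^-1 y, so N(p) avoids N(z^-1 y). *)
have zpy : weak_orth (z * p) y.
  move=> t; rewrite inverts_orthM // => /orP[/zyo//|].
  have /[apply] : weak_orth p (z^-1 * y).
    apply: (weak_orth_parabolic JS) Jp => c Jc.
    rewrite invertsM (negPf (Jz c Jc)) /=; case: (JP c Jc) => _; apply.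
    rewrite inverts_orthM; last exact: zJ_orth.
    by rewrite conjgKV (inverts_gen _ (JS c Jc)) eqxx orbT.
  rewrite invertsM invertsV conjgK; apply: contraNN => yt.
  by rewrite yt (negPf (weak_orth_sym zyo yt)).
have Ja : J a by left.
have Jb : J b by right.
have zc_zp c : J c -> weak_le (z * c) (z * p).
  move=> Jc; apply/weak_leM2l => //; first exact: zJ_orth.
  by apply: weak_le_gen; [exact: JS|exact: pJ].
(* First y1 is joined with zp above za, then the result is joined with y2 above zb. *)
have [j1 [j1x j1y y1j1 zpj1 j1_min]] :=
  IHn _ _ _ (lJ a Ja) ay1 (zc_zp a Ja) y1x y1y zpx zpy.
have [j [jx jy j1j y2j j_min]] :=
  IHn _ _ _ (lJ b Jb) (weak_le_trans (zc_zp b Jb) zpj1) by2 j1x j1y y2x y2y.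
exists j; split=> // [|v y1v y2v]; first exact: weak_le_trans j1j.
have zv := weak_le_trans zy1 y1v.
(* An upper bound v of y1 and y2 is also above zp, because [a] and [b] are descents of z^-1 v. *)
apply: (j_min) => //; apply: j1_min => //.
rewrite -(mulVKg z v); apply/weak_leM2l => //; first exact/weak_leP.
apply: (weak_le_parabolic JS) Jp => c [->|->]; apply: le_lift => //.
- exact: weak_le_trans y1v.
- exact: weak_le_trans y2v.
Qed.

Definition weak_join (X : set W) j :=
  (forall w, X w -> weak_le w j) /\
  (forall v, (forall w, X w -> weak_le w v) -> weak_le j v).

(** The join is a longest j among the elements below x, orthogonal to y and below all upper bounds
    of [X]. For w in [X], the join of j and w is again such an element, so it equals j. *)
Lemma weak_join_orth (X : set W) x y :
  (forall w, X w -> weak_le w x /\ weak_orth w y) ->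
  exists2 j, weak_join X j & weak_orth j y.
Proof.
move=> Xxy.
pose Q j := [/\ weak_le j x, weak_orth j y &
  forall v, (forall w, X w -> weak_le w v) -> weak_le j v].
pose P n := `[< exists2 j, Q j & l j = n >].
have exP : exists n, P n.
  exists (l 1); apply/asboolP; exists 1 => //.
  by split=> [||v _]; [exact: weak_le1|move=> t; rewrite inverts1|
    exact: weak_le1].
have ubP n : P n -> (n <= l x)%N.
  by case/asboolP=> j [jx _ _] <-; exact: weak_le_length.
case: (ex_maxnP exP ubP) => _ /asboolP[j [jx jy j_min] <-] max_j.
exists j => //; split=> // w Xw; have [wx wy] := Xxy w Xw.
have [k [kx ky jk wk k_min]] := weak_join2 jx jy wx wy.
rewrite (weak_le_eq jk) //; apply: max_j; apply/asboolP; exists k => //.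
by split=> // v Xv; apply: k_min; [exact: j_min|exact: Xv].
Qed.

Lemma weak_join_exists (X : set W) x :
  (forall w, X w -> weak_le w x) -> exists j, weak_join X j.
Proof.
move=> Xx; have [w Xw|j Xj _] := @weak_join_orth X x 1; last by exists j.
by split=> [|t]; [exact: Xx|rewrite inverts1].
Qed.

Lemma weak_join_unique (X : set W) j k : weak_join X j -> weak_join X k ->
  j = k.
Proof.
by move=> [Xj j_min] [Xk k_min]; apply: weak_le_anti; [exact: j_min|
  exact: k_min].
Qed.

Lemma weak_JOP (X : set W) x y : weak_join X x ->
  (forall z, X z -> weak_orth z y) -> weak_orth x y.
Proof.
move=> Xx Xy; have [w Xw|j Xj jy] := @weak_join_orth X x y.
  by split; [case: Xx => + _; apply|exact: Xy].
by rewrite (weak_join_unique Xx Xj).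
Qed.

Definition weak_meet (X : set W) m :=
  (forall w, X w -> weak_le m w) /\
  (forall v, (forall w, X w -> weak_le v w) -> weak_le v m).

(** The meet is the join of the lower bounds, a set bounded by any member of [X]. *)
Lemma weak_meet_exists (X : set W) : X !=set0 -> exists m, weak_meet X m.
Proof.
move=> [x Xx].
have [v|m [m_ub m_min]] :=
  @weak_join_exists [set v | forall w, X w -> weak_le v w] x; first exact.
exists m; split=> [w Xw|v Xv]; last exact: m_ub.
by apply: m_min => v; apply.
Qed.

Lemma weak_meet_unique (X : set W) m k : weak_meet X m -> weak_meet X k ->
  m = k.
Proof.
by move=> [Xm m_max] [Xk k_max]; apply: weak_le_anti; [exact: k_max|
  exact: m_max].
Qed.

(** * Automorphisms, fixed elements and orbits *)

Section Automorphisms.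
Variable G : automorphism_group S.

Lemma aut_morph sigma : auts G sigma -> {morph sigma : x y / x * y}.
Proof. by case/auts_automorphism. Qed.

Lemma aut1 sigma : auts G sigma -> sigma 1 = 1.
Proof.
by move=> /aut_morph sM; apply: (mulgI (sigma 1)); rewrite -sM !mulg1.
Qed.

Lemma autV sigma x : auts G sigma -> sigma x^-1 = (sigma x)^-1.
Proof.
by move=> Gs; apply/esym/mulg1_eq; rewrite -(aut_morph Gs) mulgV (aut1 Gs).
Qed.

Lemma aut_gen sigma s : auts G sigma -> S s -> S (sigma s).
Proof. by case/auts_automorphism => _ _ sS Ss; rewrite -sS; exists s. Qed.

Lemma aut_length sigma w : auts G sigma -> l (sigma w) = l w.
Proof.
suff le tau x : auts G tau -> (l (tau x) <= l x)%N.
  move=> Gs; have [tau [Gt sK _]] := auts_inv Gs.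
  by apply/eqP; rewrite eqn_leq le //= -{1}(sK w) le.
move=> Gt; have [[ss [Sss ->] <-] _] := coxeter_lengthP x.
have [_] := coxeter_lengthP (tau (\prod_(s <- ss) s)).
rewrite -(size_map tau); apply; split.
  by move=> _ /mapP[s /Sss Ss ->]; exact: aut_gen.
rewrite big_map; elim: ss {Sss} => [|s ss IHss]; first
  by rewrite !big_nil (aut1 Gt).
by rewrite !big_cons (aut_morph Gt) IHss.
Qed.

Lemma aut_inverts sigma w t : auts G sigma ->
  inverts (sigma w) (sigma t) = inverts w t.
Proof.
move=> Gs; have [tau [Gt sK _]] := auts_inv Gs.
have refl rho r : auts G rho -> reflections S r -> reflections S (rho r).
  move=> Gr [u [s Ss ->]]; exists (rho u), (rho s); first exact: aut_gen.
  by rewrite -(autV _ Gr) !(aut_morph Gr).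
rewrite /inverts -(aut_morph Gs) !(aut_length _ Gs); congr (_ && _).
apply/asboolP/asboolP; last exact: refl.
by move=> /(refl tau _ Gt); rewrite sK.
Qed.

Lemma aut_weak_le sigma x y : auts G sigma ->
  weak_le x y -> weak_le (sigma x) (sigma y).
Proof.
move=> Gs xy t; have [tau [Gt _ tK]] := auts_inv Gs.
by rewrite -(tK t) !(aut_inverts _ _ Gs); exact: xy.
Qed.

Lemma aut_weak_orth sigma x y : auts G sigma ->
  weak_orth x y -> weak_orth (sigma x) (sigma y).
Proof.
move=> Gs xy t; have [tau [Gt _ tK]] := auts_inv Gs.
by rewrite -(tK t) !(aut_inverts _ _ Gs); exact: xy.
Qed.

Definition fixed w := forall sigma, auts G sigma -> sigma w = w.

Definition stable (X : set W) :=
  forall sigma w, auts G sigma -> X w -> X (sigma w).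

Lemma fixed_stable (X : set W) : X `<=` fixed -> stable X.
Proof. by move=> Xf sigma w Gs Xw; rewrite (Xf w Xw). Qed.

(** An automorphism permutes [X] and preserves the order, so it sends a join of [X] to a join of
    [X]; joins are unique. *)
Lemma weak_join_fixed (X : set W) j : stable X -> weak_join X j -> fixed j.
Proof.
move=> stX Xj sigma Gs; apply: weak_join_unique (Xj).
have [tau [Gt sK tK]] := auts_inv Gs; case: Xj => Xj j_min.
split=> [w Xw|v Xv].
  by rewrite -(tK w); apply: aut_weak_le => //; apply/Xj/stX.
rewrite -(tK v); apply: aut_weak_le => //; apply: j_min => w Xw.
by rewrite -(sK w); apply: aut_weak_le => //; apply/Xv/stX.
Qed.

Lemma weak_meet_fixed (X : set W) m : stable X -> weak_meet X m -> fixed m.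
Proof.
move=> stX Xm sigma Gs; apply: weak_meet_unique (Xm).
have [tau [Gt sK tK]] := auts_inv Gs; case: Xm => Xm m_max.
split=> [w Xw|v Xv].
  by rewrite -(tK w); apply: aut_weak_le => //; apply/Xm/stX.
rewrite -(tK v); apply: aut_weak_le => //; apply: m_max => w Xw.
by rewrite -(sK w); apply: aut_weak_le => //; apply/Xv/stX.
Qed.

Lemma orbit_sub (J : set W) : is_orbit G J -> forall s, J s -> S s.
Proof. by move=> [r Sr ->] _ [sigma Gs <-]; exact: aut_gen. Qed.

Lemma orbit_stable (J : set W) : is_orbit G J -> stable J.
Proof.
move=> [r _ ->] sigma _ Gs [tau Gt <-].
by exists (sigma \o tau) => //; exact: auts_comp.
Qed.

Lemma orbit_inverts (J : set W) g s r : is_orbit G J -> fixed g ->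
  J s -> inverts g s -> J r -> inverts g r.
Proof.
move=> [u _ ->] gf [sigma Gs <-] gs [tau Gt <-].
have [rho [Gr sK _]] := auts_inv Gs.
rewrite -(gf tau Gt) (aut_inverts _ _ Gt).
by rewrite -(gf sigma Gs) (aut_inverts _ _ Gs) in gs.
Qed.

Lemma parabolic_stable (J : set W) : stable J -> stable (subgroup_generated J).
Proof.
move=> stJ sigma w Gs Jw; have [J1 JM JV] := subgroup_generated_subgroup J.
move: w Jw; apply: subgroup_generated_ind => [|x y Jx Jy|x Jx|s Js].
- by rewrite (aut1 Gs).
- by rewrite (aut_morph Gs); exact: JM.
- by rewrite (autV _ Gs); exact: JV.
- exact: sub_gen (stJ _ _ Gs Js).
Qed.

Lemma longest_inverts (J : set W) p s : (forall s, J s -> S s) ->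
  is_longest_element S J p -> J s -> inverts p s.
Proof.
move=> JS [Jp max_p] Js; have [_ JM _] := subgroup_generated_subgroup J.
apply/negPn/negP => /(length_ascent (JS s Js)) lsp.
by have := max_p _ (JM _ _ (sub_gen Js) Jp); rewrite lsp ltnn.
Qed.

(** All of W_J lies below p, including sigma(p), which has the same length as p. *)
Lemma longest_fixed (J : set W) p :
  is_orbit G J -> is_longest_element S J p -> fixed p.
Proof.
move=> oJ Jp sigma Gs; have JS := orbit_sub oJ.
apply: weak_le_eq; last by rewrite (aut_length _ Gs).
apply: (weak_le_parabolic JS) => [s Js|]; first exact: longest_inverts Jp Js.
by apply: (parabolic_stable (orbit_stable oJ) Gs); case: Jp.
Qed.

Lemma longest_elements_fixed p : longest_elements_of_orbits G p -> fixed p.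
Proof. by case=> J [oJ _ Jp]; exact: longest_fixed oJ Jp. Qed.

Lemma longest_below g : fixed g -> g <> 1 ->
  exists p, [/\ longest_elements_of_orbits G p, p <> 1 & weak_le p g].
Proof.
move=> gf /descent_exists[s Ss gs]; pose J := [set sigma s | sigma in auts G].
have oJ : is_orbit G J by exists s.
have JS := orbit_sub oJ.
have Js : J s by exists id => //; exact: auts_id.
have [r Jr|p [Jp pJ pg]] := @longest_parabolic J g JS.
  exact: orbit_inverts Js gs Jr.
have Jle u : subgroup_generated J u -> weak_le u p.
  by move=> Ju; exact: weak_le_parabolic Ju.
exists p; split=> //; last first.
  by move=> p1; have := pJ s Js; rewrite p1 inverts1.
(* W_J is finite because it is contained in the finite interval below p. *)
exists J; split=> //; first exact: sub_finite_set (weak_interval_finite p).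
by split=> // u /Jle/weak_le_length.
Qed.

(** One direction is [longest_below]. For the other, a nontrivial fixed z below w_J has a descent,
    which lies in [J]; hence all of [J] consists of descents of z, and w_J lies below z. *)
Lemma fixed_atomP w : fixed w ->
  (w <> 1 /\ (forall z, fixed z -> z <> 1 -> weak_le z w -> z = w)) <->
  longest_elements_of_orbits G w.
Proof.
move=> wf; split=> [[w1 min_w]|[J [oJ _ Jw]]].
  have [p [Gp p1 pw]] := longest_below wf w1.
  by rewrite -(min_w p) //; exact: longest_elements_fixed.
have JS := orbit_sub oJ; case: (Jw) => JJw _.
split=> [w1|z zf z1 zw].
  case: (oJ) => s _ JE; have Js : J s.
    by rewrite JE; exists id => //; exact: auts_id.
  by have := longest_inverts JS Jw Js; rewrite w1 inverts1.
have [s Ss zs] := descent_exists z1.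
have Js : J s.
  apply: (gen_parabolic JS) => //.
  exact: parabolic_inverts JJw (zw _ zs).
apply: weak_le_anti => //; apply: (weak_le_parabolic JS) JJw => r Jr.
exact: orbit_inverts Js zs Jr.
Qed.

Lemma longest_orth p g : longest_elements_of_orbits G p -> fixed g ->
  weak_le p g \/ weak_orth p g.
Proof.
move=> [J [oJ _ [Jp _]]] gf; have JS := orbit_sub oJ.
have [[s Js gs]|nJ] := pselect (exists2 s, J s & inverts g s).
  by left; apply: (weak_le_parabolic JS) Jp => r; exact: orbit_inverts Js gs.
right; apply: (weak_orth_parabolic JS) Jp => s Js.
by apply/negP => gs; apply: nJ; exists s.
Qed.

(* The bound is the join of the orbit of [w]. *)
Lemma fixed_upper_bound w v y :
  fixed v -> fixed y -> weak_le w v -> weak_orth w y ->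
  exists j, [/\ fixed j, weak_orth j y, weak_le w j &
    forall u, fixed u -> weak_le w u -> weak_le j u].
Proof.
move=> vf yf wv wy; pose X := [set sigma w | sigma in auts G].
have [_ [sigma Gs <-]|j Xj jy] := @weak_join_orth X v y.
  by rewrite -(vf _ Gs) -(yf _ Gs); split; [exact: aut_weak_le|
    exact: aut_weak_orth].
exists j; split=> //.
- apply: weak_join_fixed Xj => sigma _ Gs [tau Gt <-].
  by exists (sigma \o tau) => //; exact: auts_comp.
- by case: Xj => + _; apply; exists id => //; exact: auts_id.
- move=> u uf wu; case: Xj => _; apply=> _ [sigma Gs <-].
  by rewrite -(uf _ Gs); exact: aut_weak_le.
Qed.

End Automorphisms.

(** * Transfer from the weak order to the stars of a triple *)

(* [el] identifies a star of [Q] with a subset [F] of [W] that is closed under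
   the meets and joins of the weak order. *)
Record weak_model (Q : triple) (a : gpd Q) (el : star a -> W) (F : set W) :
    Prop := WeakModel {
  model_inj : injective el;
  model_mem : forall x, F (el x);
  model_surj : forall w, F w -> exists x, el x = w;
  model_one : el (star1 a) = 1;
  model_wle : forall x y, wle x y <-> weak_le (el x) (el y);
  model_orth : forall x y, orth x y <-> weak_orth (el x) (el y);
  meet_closed : forall X m, X `<=` F -> weak_meet X m -> F m;
  join_closed : forall X j, X `<=` F -> weak_join X j -> F j
}.

Section WeakModel.
Variables (Q : triple) (a : gpd Q) (el : star a -> W) (F : set W).
Hypothesis M : weak_model el F.

Let image_sub (X : set (star a)) : el @` X `<=` F.
Proof. by move=> _ [x _ <-]; exact: (model_mem M). Qed.

(** Returning both meets lets antisymmetry turn any meet in the star into a meet in W. *)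
Lemma model_meet_exists (X : set (star a)) : X !=set0 ->
  exists2 m, is_meet X m & weak_meet (el @` X) (el m).
Proof.
move=> [x0 Xx0]; have [|m Xm] := @weak_meet_exists (el @` X).
  by exists (el x0); exists x0.
have [x xm] := model_surj M (meet_closed M (@image_sub X) Xm); exists x; last
  by rewrite xm.
case: Xm => m_lb m_max; split=> [y Xy|z zX].
  by apply/(model_wle M); rewrite xm; apply: m_lb; exists y.
by apply/(model_wle M); rewrite xm; apply: m_max => _ [y Xy <-];
  exact/(model_wle M)/zX.
Qed.

Lemma model_le_anti (x y : star a) : wle x y -> wle y x -> x = y.
Proof. by move=> /(model_wle M) xy /(model_wle M) yx;
  apply/(model_inj M)/weak_le_anti. Qed.

Lemma model_meet (X : set (star a)) x : X !=set0 -> is_meet X x ->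
  weak_meet (el @` X) (el x).
Proof.
move=> X0 [x_lb x_max]; have [m [m_lb m_max] Xm] := model_meet_exists X0.
by rewrite (@model_le_anti x m) //; [exact: m_max|exact: x_max].
Qed.

(** A join in the star is least only among bounds in [F]. The join in W exists because [el x] is a
    bound, lies in [F] by [join_closed], and therefore equals [el x]. *)
Lemma model_join (X : set (star a)) x : is_join X x ->
  weak_join (el @` X) (el x).
Proof.
move=> [x_ub x_min]; have [_ [y Xy <-]|j Xj] :=
  @weak_join_exists (el @` X) (el x).
  exact/(model_wle M)/x_ub.
have [y yj] := model_surj M (join_closed M (@image_sub X) Xj).
have [j_ub j_min] := Xj.
suff -> : x = y by rewrite yj.
apply: model_le_anti.
  by apply: x_min => z Xz; apply/(model_wle M); rewrite yj; apply: j_ub;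
    exists z.
by apply/(model_wle M); rewrite yj; apply: j_min => _ [z Xz <-];
  exact/(model_wle M)/x_ub.
Qed.

Lemma model_JOP : JOP a.
Proof.
move=> X x y _ /model_join Xx Xy; apply/(model_orth M)/(weak_JOP Xx).
by move=> _ [z Xz <-]; exact/(model_orth M)/Xy.
Qed.

Lemma model_complete : complete_meet_semilattice a.
Proof. by move=> X /model_meet_exists[m Xm _]; exists m. Qed.

Lemma model_interval_finite : interval_finite a.
Proof.
move=> x y; apply: (@sub_finite_set _ _ (el @^-1` [set w | weak_le w (el y)])).
  by move=> z [_ /(model_wle M)].
by apply: finite_preimage; [move=> ? ? _ _; exact: (model_inj M)|
  exact: weak_interval_finite].
Qed.

(** A morphism with zero cocycle is orthogonal to itself, so its image in W has no descent. *)
Lemma model_faithful b (g : hom a b) : coc g = 0%R -> in_star g = star1 a.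
Proof.
move=> g0; apply: (model_inj M); rewrite (model_one M).
have /(model_orth M) gg : orth (in_star g) (in_star g).
  by rewrite /orth /scoc /= g0 capxx.
have [//|/eqP g1] := eqVneq (el (in_star g)) 1.
by have [s _ gs] := descent_exists g1; have := gg _ gs; rewrite gs.
Qed.

Lemma model_atom (r : star a) : is_atom r <->
  el r <> 1 /\ (forall z, F z -> z <> 1 -> weak_le z (el r) -> z = el r).
Proof.
split=> [[r1 min_r]|[r1 min_r]].
  split=> [|z Fz z1 zr]; first by rewrite -(model_one M) => /(model_inj M).
  have [x xz] := model_surj M Fz; rewrite -xz (min_r x) //; last first.
    by apply/(model_wle M); rewrite xz.
  by move=> x1; apply: z1; rewrite -xz x1 (model_one M).
split=> [E|z z1 /(model_wle M) zr]; first by apply: r1; rewrite E (model_one M).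
apply: (model_inj M); apply: min_r => //; first exact: (model_mem M).
by rewrite -(model_one M) => /(model_inj M).
Qed.

End WeakModel.

(** * Inversion sets as elements of the Boolean ring *)

Lemma inversion_setE w (t : reflections S) :
  inversion_set S w t = inverts w (val t) :> Prop.
Proof.
apply/propext; rewrite /inverts; split=> [wt|/andP[]//].
by apply/andP; split=> //; apply/asboolP/set_mem/(valP t).
Qed.

Lemma inverts_reflection w t : inverts w t ->
  exists2 r : reflections S, val r = t & inversion_set S w r.
Proof.
move=> wt; have Rt : t \in reflections S by apply/mem_set/asboolP;
  case/andP: wt.
by exists (Sub t Rt); rewrite ?inversion_setE.
Qed.

Lemma standard_wle w v :
  subb (inversion_set S w) (inversion_set S v) <-> weak_le w v.
Proof.
split=> [E t /inverts_reflection[r <-]|wv].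
  by rewrite -E => -[_]; rewrite inversion_setE.
apply/seteqP; split=> [t []//|t wt]; split=> //.
by move: wt; rewrite !inversion_setE; exact: wv.
Qed.

Lemma standard_orth w v :
  cap (inversion_set S w) (inversion_set S v) = 0%R <-> weak_orth w v.
Proof.
split=> [E t /inverts_reflection[r <- wr]|wv].
  apply/negP => vr.
  have : (inversion_set S w `&` inversion_set S v) r.
    by split=> //; rewrite inversion_setE.
  by rewrite -[_ `&` _]/(cap _ _) E.
apply/seteqP; split=> [t []|//].
by rewrite !inversion_setE => /wv/negP.
Qed.

Lemma standard_protorootoid : is_protorootoid (standard_rootoid S).
Proof.
move=> [] [] [] g h /=; apply/funext => t.
have -> : (inversion_set S g + conj_map g (inversion_set S h))%R t =
  (inversion_set S g `+` conj_map g (inversion_set S h)) t by [].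
rewrite /setY /setU /setD /mkset conj_mapE !inversion_setE invertsM conjgE /=
  invgK mulgA.
(* This lets [tauto] treat [is_true false] as absurd. *)
have nF : ~ is_true false by [].
by apply/propext; case: (inverts g _); case: (inverts h _) => /=; tauto.
Qed.

End Presentation.

Definition group_star (H : groupType) (a : group_groupoid H) (x : star a) : H :=
  projT2 x.

Lemma group_star_inj (H : groupType) (a : group_groupoid H) :
  injective (@group_star H a).
Proof. by case: a => -[[] x] [[] y] /= <-. Qed.

Lemma group_star_surj (H : groupType) (a : group_groupoid H) x :
  exists y : star a, group_star y = x.
Proof. by exists (@in_star (group_groupoid H) a a x). Qed.

Lemma pullback_protorootoid (R : triple) (H : groupoid)
    (i : groupoid_hom H (gpd R)) :
  is_protorootoid R -> is_protorootoid (pullback i).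
Proof. by move=> RP a b c g h; rewrite /= hom_mapM; exact: RP. Qed.

(** * The standard rootoid and its restriction to the fixed subgroup *)

Section StandardRootoid.
Variables (W : groupType) (S : set W).
Hypothesis cox : coxeter_system S.

Lemma standard_weak_model (a : gpd (standard_rootoid S)) :
  weak_model S (@group_star W a : @star (gpd (standard_rootoid S)) a -> W) setT.
Proof.
split=> //; first exact: group_star_inj.
- by move=> w _; exact: group_star_surj.
- by move=> x y; exact: standard_wle.
- by move=> x y; exact: standard_orth.
Qed.

Lemma standard_rootoid_is_rootoid : is_rootoid (standard_rootoid S).
Proof.
split=> [|a b g|a|a].
- exact: standard_protorootoid.
- exact: (model_faithful cox (standard_weak_model a)).
- exact: (model_complete cox (standard_weak_model a)).
- exact: (model_JOP cox (standard_weak_model a)).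
Qed.

Variable G : automorphism_group S.
Let R : triple := standard_rootoid S.
Let i : groupoid_hom (group_groupoid (fixed_group G)) (gpd R) :=
  group_groupoid_hom (fixed_inclusion G).
Let T : triple := pullback i.

Definition fixed_star (a : gpd T) (x : star a) : W := val (group_star x).

Lemma fixed_star_inj a : injective (@fixed_star a).
Proof. by move=> x y /val_inj/group_star_inj. Qed.

Lemma fixed_starP a x : fixed G (@fixed_star a x).
Proof. exact/asboolP/(valP (group_star x)). Qed.

Lemma fixed_star_surj a w : fixed G w -> exists x, @fixed_star a x = w.
Proof.
move=> /asboolP wf; have [x xw] := group_star_surj a (Sub w wf : fixed_group G).
by exists x; rewrite /fixed_star xw.
Qed.

(** Restriction keeps the cocycle, so order and orthogonality are read off in W; a set of fixed
    elements is stable, so its meets and joins are fixed. *)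
Lemma fixed_weak_model (a : gpd T) : weak_model S (@fixed_star a) (fixed G).
Proof.
split=> [||||x y|x y|X m|X j] //.
- exact: fixed_star_inj.
- exact: fixed_starP.
- exact: fixed_star_surj.
- exact: standard_wle.
- exact: standard_orth.
- by move=> /fixed_stable; exact: weak_meet_fixed.
- by move=> /fixed_stable; exact: weak_join_fixed.
Qed.

Lemma fixed_rootoid : is_rootoid T.
Proof.
split=> [|a b g|a|a].
- exact/pullback_protorootoid/standard_protorootoid.
- exact: (model_faithful cox (fixed_weak_model a)).
- exact: (model_complete cox (fixed_weak_model a)).
- exact: (model_JOP cox (fixed_weak_model a)).
Qed.

Lemma fixed_atom (a : gpd T) (r : star a) :
  is_atom (R := T) r <-> longest_elements_of_orbits G (fixed_star r).
Proof.
rewrite -(fixed_atomP cox (fixed_starP r)).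
exact: (model_atom (fixed_weak_model a)).
Qed.

Lemma fixed_preprincipal : is_preprincipal T.
Proof.
split; first exact: fixed_rootoid.
  move=> a.
  exact: (model_interval_finite cox (fixed_weak_model a)).
move=> a r g /fixed_atom Gr.
have [rg|rg] := longest_orth cox Gr (fixed_starP g).
  by left; exact/(model_wle (fixed_weak_model a)).
by right; exact/(model_orth (fixed_weak_model a)).
Qed.

Lemma fixed_atomic_generators :
  [set val (group_elt r) | r in @atomic_generators T] =
  longest_elements_of_orbits G.
Proof.
apply/seteqP; split=> [_ [[a r] /fixed_atom Gr <-]|w Gw]; first exact: Gr.
have [r rw] := @fixed_star_surj tt w (longest_elements_fixed cox Gw).
exists (existT _ tt r); last exact: rw.
by apply/fixed_atom; rewrite rw.
Qed.

Lemma fixed_RdE_morphism : is_RdE_morphism (pullback_morphism i).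
Proof.
split; [exact: fixed_rootoid|exact: standard_rootoid_is_rootoid|move=> a].
have M := standard_weak_model a.
have range_fixed (x : @star (gpd R) a) : fixed G (group_star x) ->
    range (star_map i (a := a)) x.
  move=> /(@fixed_star_surj a)[y yx]; exists y => //.
  exact: group_star_inj.
have fixed_range (X : set (@star (gpd R) a)) :
    X `<=` range (star_map i (a := a)) ->
    (@group_star W a) @` X `<=` fixed G.
  by move=> Xi _ [x /Xi[y _ <-] <-]; exact: fixed_starP.
split.
(* The cocycle of [T] is that of [R] on fixed elements, so the two orders agree by definition. *)
- split; last by move=> x y; exact: iff_refl.
  by move=> x y /(congr1 (@group_star W a)) /fixed_star_inj.
- move=> X X0 Xi; split=> x Xx; apply: range_fixed.
    exact: (meet_closed (fixed_weak_model a) (fixed_range _ Xi)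
      (model_meet cox M X0 Xx)).
  exact: (join_closed (fixed_weak_model a) (fixed_range _ Xi)
    (model_join cox M Xx)).
(* The witness for theta^perp(w) is the least fixed element above w; it exists because v bounds w,
   and it stays orthogonal to u. *)
- move=> u w [v wv] uw.
  have [j [jf jy wj j_min]] := fixed_upper_bound cox (fixed_starP v)
    (fixed_starP u) (iffLR (model_wle M _ _) wv)
    (weak_orth_sym (iffLR (standard_orth _ _ _) uw)).
  have [y yj] := fixed_star_surj a jf; exists y.
    split=> [|z wz]; first by apply/(model_wle M); rewrite -yj in wj; exact: wj.
    apply/(model_wle (fixed_weak_model a)); rewrite yj.
    by apply: j_min; [exact: fixed_starP|exact: iffLR (model_wle M _ _) wz].
  by apply/(model_orth (fixed_weak_model a))/weak_orth_sym; rewrite yj.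
Qed.

End StandardRootoid.

Theorem proposition13p2 (W : groupType) (S : set W) (hWS : coxeter_system S)
    (G : automorphism_group S) :
  let R : triple := standard_rootoid S in
  let i : groupoid_hom (group_groupoid (fixed_group G)) (gpd R) :=
    group_groupoid_hom (fixed_inclusion G) in
  let T : triple := pullback i in
  [/\ is_preprincipal T,
      [set val (group_elt r) | r in @atomic_generators T]%classic =
        longest_elements_of_orbits G &
      is_RdE_morphism (pullback_morphism i)].
Proof.
split; [exact: fixed_preprincipal|exact: fixed_atomic_generators|].
exact: fixed_RdE_morphism.
Qed.
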